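(* Let $d>2$ be an integer, and let $a,n$ be integers with $0\le a\le n-d$. Let $M:=\max\{\min\{a,n-a\},\min\{a+d,n-a-d\}\}$. Then the ballot $\preceq$-minimal sets in $\operatorname{osh}\left(\binom{[n]}a\cup\binom{[n]}{a+d}\right)$ are exactly the following: - $B_m:=\{2,4,\ldots,2m\}$ for every integer $0\leq m\leq M$; - in addition, if $a<n/2<a+d$, the sets $B_{m,j}:=\{2,4,\ldots,2m,\;2m+d,2m+d+1,\ldots,2m+d+j-1\}$ for all integers $0\leq m\leq a$ and $j\geq 1$ satisfying $m+j>M=\max\{a,n-a-d\}$ and $2m+2j\leq 2m+d+j-1\leq n$. (In $B_{m,j}$ the initial part consists of the even numbers from $2$ to $2m$, followed by all integers in $[2m+d,2m+d+j-1]$.)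
   Context: $[n]=\{1,\ldots,n\}$; $[a,b]=\{a,a+1,\ldots,b\}$, which is empty if $a>b$; $\mathcal{P}(A)$ is the set of all subsets of $A$ and $\binom{A}{k}$ the collection of all $k$-element subsets of $A$. Order shattering. Let $S\subseteq[n]$ and $\mathcal{F}\subseteq\mathcal{P}([n])$. Inductively: $S=\varnothing$ is order shattered by $\mathcal{F}$ iff $\mathcal{F}\neq\varnothing$. If $S=\{s_1<s_2<\cdots<s_k\}$ with $k\ge1$, then $S$ is order shattered by $\mathcal{F}$ iff there exist disjoint families $\widetilde{\mathcal{F}_0},\widetilde{\mathcal{F}_1}\subseteq\mathcal{F}$, each of size $2^{k-1}$, such that, with $T=[s_k+1,n]$ (possibly empty): (a) $T\cap C=T\cap D$ for all $C\in\widetilde{\mathcal{F}_0}$ and $D\in\widetilde{\mathcal{F}_1}$; (b) $s_k\notin C$ and $s_k\in D$ for all $C\in\widetilde{\mathcal{F}_0}$ and $D\in\widetilde{\mathcal{F}_1}$; (c) each of $\widetilde{\mathcal{F}_0}$ and $\widetilde{\mathcal{F}_1}$ individually order shatters $S\setminus\{s_k\}$. Then $\operatorname{osh}(\mathcal{F})=\{S\subseteq[n]:\mathcal{F}\text{ order shatters }S\}$. A set $S=\{s_1<\cdots<s_k\}\subseteq[n]$ is a ballot set if $s_i\ge 2i$ for every $i\in[k]$. Partial order $\preceq$ on $\mathcal{P}([n])$: sets of different sizes are incomparable; if $S=\{s_1<\cdots<s_k\}$ and $S'=\{s_1'<\cdots<s_k'\}$, then $S\preceq S'$ iff $s_i\le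 s_i'$ for every $i\in[k]$. $S\prec S'$ means $S\preceq S'$ and $S\ne S'$. A $\preceq$-minimal set in a family is a member $S$ of the family such that no member $S'$ of the family satisfies $S'\prec S$. *)

(* Defs.v *)
From mathcomp Require Import all_boot.

Set Implicit Arguments.
Unset Strict Implicit.
Unset Printing Implicit Defensive.

(* The ground set {1, ..., n} is represented by 'I_n, where
   x : 'I_n stands for the integer x.+1. *)

Definition layer (n k : nat) : {set {set 'I_n}} :=
  [set A : {set 'I_n} | #|A| == k].

Inductive order_shatters (n : nat) :
    {set {set 'I_n}} -> {set 'I_n} -> Prop :=
| OrderShatters0 (F : {set {set 'I_n}}) :
    F != set0 -> order_shatters F set0
| OrderShattersS (F F0 F1 : {set {set 'I_n}}) (S : {set 'I_n}) (s : 'I_n) :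
    s \in S ->
    (forall x, x \in S -> x <= s) ->
    F0 \subset F -> F1 \subset F -> [disjoint F0 & F1] ->
    #|F0| = 2 ^ #|S|.-1 -> #|F1| = 2 ^ #|S|.-1 ->
    (forall C D, C \in F0 -> D \in F1 ->
       [set x : 'I_n | s < x] :&: C = [set x : 'I_n | s < x] :&: D) ->
    (forall C D, C \in F0 -> D \in F1 -> s \notin C /\ s \in D) ->
    order_shatters F0 (S :\ s) -> order_shatters F1 (S :\ s) ->
    order_shatters F S.

Definition osh (n : nat) (F : {set {set 'I_n}}) : {set 'I_n} -> Prop :=
  fun S => order_shatters F S.

(* The elements of S as integers in {1, ..., n}, in increasing order:
   s_i is nth 0 (elts S) i.-1. *)
Definition elts (n : nat) (S : {set 'I_n}) : seq nat :=
  [seq (val x).+1 | x <- enum S].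

Lemma size_elts (n : nat) (S : {set 'I_n}) : size (elts S) = #|S|.
Proof. by rewrite size_map cardE. Qed.

Lemma elts_sorted (n : nat) (S : {set 'I_n}) : sorted ltn (elts S).
Proof.
rewrite /elts sorted_map /enum_mem -enumT; apply: sorted_filter.
  by move=> y x z /=; apply: ltn_trans.
by have := iota_ltn_sorted 0 n; rewrite -val_enum_ord sorted_map.
Qed.

Definition ballot (n : nat) (S : {set 'I_n}) : Prop :=
  forall i, 1 <= i <= #|S| -> 2 * i <= nth 0 (elts S) i.-1.

Definition preceq (n : nat) (S S' : {set 'I_n}) : Prop :=
  #|S| = #|S'| /\
  forall i, 1 <= i <= #|S| -> nth 0 (elts S) i.-1 <= nth 0 (elts S') i.-1.

Definition prec (n : nat) (S S' : {set 'I_n}) : Prop :=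
  preceq S S' /\ S <> S'.

Definition preceq_minimal (n : nat) (P : {set 'I_n} -> Prop)
    (S : {set 'I_n}) : Prop :=
  P S /\ forall S', P S' -> ~ prec S' S.

Definition evens (m : nat) : seq nat := [seq 2 * i | i <- iota 1 m].

(* Members of the lists below that exceed n would be dropped; none does
   when 2 * m <= n, respectively 2 * m + d + j - 1 <= n (and 1 <= j). *)
Definition B (n m : nat) : {set 'I_n} := [set x : 'I_n | x.+1 \in evens m].

Definition Bj (n d m j : nat) : {set 'I_n} :=
  [set x : 'I_n | x.+1 \in evens m ++ iota (2 * m + d) j].

(* Main.v *)
Require Import Defs.
From mathcomp Require Import all_boot zify.

(** Everything about [S] is read off the counting function [cnt S q], the number
of elements of [S] among 1, ..., q: ballot sets are those with
[2 * cnt S q <= q] for all [q], and the partial order is the reversed pointwise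
order of counting functions ([ballotP], [preceqP]).

Families that consist of all sets of certain sizes turn order shattering into a
game ([osh_win]).  Positions are visited from [n] down to 1; at a position
outside [S] the player decides whether it belongs to the common part of the
sets, at a position of [S] the adversary decides, and at the end the number of
chosen positions must be an allowed size.  For one size, the numbers chosen so
far from which the player wins with [p] positions left form an interval, which
a position outside [S] extends and a position of [S] shrinks; it has
[p - 2 * cnt S p + 1] points while [S] is ballot up to [p], and is empty from
the first failure on.  For the sizes [a] and [a + d] there are two such
intervals at distance [d].  They become contiguous as soon as
[d <= p.+1 - 2 * cnt S p], and from then on they behave as one interval with
[d] more points, which survives as long as [2 * cnt S q <= q + d]
([win_two_layers]).  This describes the order shattered sets completely
([osh_two_layers]): ballot sets of size at most [M], and sets for which the
intervals merge, of size at most [minn (a + d) (n - a)].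

A ballot set of size [k] lies above [B n k], so a minimal one of size at most
[M] is [B n k] ([minimal_small_B]).  Now let [S] be minimal, ballot and of
size greater than [M].  Its intervals merge; let [p] be the first position where
they do and [m = cnt S p], so that [p = 2 * m + d - 1].  After [p] the slack
[d > 2] allows moving any element down to a free neighbour, so by minimality the
elements beyond [p] are consecutive and start at [p + 1] ([minimal_tail_down_closed]);
the elements up to [p] can be replaced by 2, 4, ..., 2m.  Thus [S = Bj n d m j]
([minimal_large_Bj]).  Conversely, a set below [B n m] or [Bj n d m j] that is
ballot or has merging intervals is pinned down by its counting function
([preceq_B_eq], [preceq_Bj_eq]). *)

Set Implicit Arguments.
Unset Strict Implicit.
Unset Printing Implicit Defensive.

(** * Counting functions *)

Definition cnt {n} (S : {set 'I_n}) (q : nat) : nat :=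
  count (fun y => y <= q) (elts S).

Lemma elts_uniq {n} (S : {set 'I_n}) : uniq (elts S).
Proof. exact: sorted_uniq ltn_trans ltnn _ (elts_sorted S). Qed.

Lemma mem_elts {n} (S : {set 'I_n}) (x : 'I_n) : (x.+1 \in elts S) = (x \in S).
Proof.
rewrite -(mem_enum S) (mem_map (f := fun x : 'I_n => (val x).+1)) //.
by move=> y z /= [] /val_inj.
Qed.

Lemma eltsP {n} (S : {set 'I_n}) y :
  reflect (exists2 x : 'I_n, x \in S & y = x.+1) (y \in elts S).
Proof.
apply: (iffP mapP) => -[x xS ->]; exists x => //; first by rewrite -mem_enum.
by rewrite mem_enum.
Qed.

Lemma cnt0 {n} (S : {set 'I_n}) : cnt S 0 = 0.
Proof.
apply/eqP; rewrite -leqn0 leqNgt -has_count; apply/hasPn => y /eltsP[x _ ->].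
by [].
Qed.

Lemma cntS {n} (S : {set 'I_n}) q :
  cnt S q.+1 = cnt S q + (q.+1 \in elts S).
Proof.
rewrite -(count_uniq_mem _ (elts_uniq S)) /cnt -count_predUI -[LHS]addn0.
congr (_ + _); first by apply: eq_count => y /=; lia.
by rewrite (@eq_count _ _ pred0) ?count_pred0 // => y /=; lia.
Qed.

Lemma cntT {n} (S : {set 'I_n}) q : n <= q -> cnt S q = #|S|.
Proof.
move=> nq; rewrite -size_elts; apply/eqP; rewrite -all_count; apply/allP => y.
by case/eltsP=> x _ -> /=; have := ltn_ord x; lia.
Qed.

Lemma cnt_mono {n} (S : {set 'I_n}) : {homo cnt S : p q / p <= q}.
Proof. by move=> p q pq; apply: sub_count => y /=; lia. Qed.

Lemma leq_cnt {n} (S : {set 'I_n}) q : cnt S q <= #|S|.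
Proof. by rewrite -size_elts count_size. Qed.

Lemma cnt_inj {n} (S S' : {set 'I_n}) :
  (forall q, q <= n -> cnt S q = cnt S' q) -> S = S'.
Proof.
move=> eqc; apply/setP => x; have xn := ltn_ord x.
have := cntS S x; have := cntS S' x.
rewrite !eqc //; last exact: ltnW.
by move=> -> /addnI /esym; rewrite !mem_elts; do 2!case: (x \in _).
Qed.

(** The Galois connection that lets [ballotP] and [preceqP] trade conditions on
the elements of a set for conditions on its counting function. *)
Lemma nth_leq_count (s : seq nat) i q :
  sorted ltn s -> i < size s ->
  (nth 0 s i <= q) = (i < count (fun y => y <= q) s).
Proof.
elim: s i => [|x s IH] i //= ps; have ss := path_sorted ps.
have gt_x := order_path_min ltn_trans ps.
have c0 : q < x -> count (fun y => y <= q) s = 0.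
  move=> qx; apply/eqP; rewrite -leqn0 leqNgt -has_count; apply/hasPn => y.
  by move/(allP gt_x) => /=; lia.
case: i => [|i] /= Hi; first by case: (leqP x q) => // /c0->.
rewrite IH //; case: (leqP x q) => [_|/c0-> //].
by rewrite add1n ltnS.
Qed.

Lemma nth_elts_leq {n} (S : {set 'I_n}) i q :
  i < #|S| -> (nth 0 (elts S) i <= q) = (i < cnt S q).
Proof. by rewrite -size_elts; exact: nth_leq_count (elts_sorted S). Qed.

Lemma ballotP {n} (S : {set 'I_n}) :
  ballot S <-> forall q, 2 * cnt S q <= q.
Proof.
split=> [bS q | bS [|i] // /= Hi]; last first.
  apply: leq_trans (bS (nth 0 (elts S) i)); rewrite leq_mul2l /= -nth_elts_leq //.
case E : (cnt S q) => [|c] //; have cS := leq_cnt S q; rewrite E in cS.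
apply: leq_trans (bS c.+1 cS) _.
by rewrite nth_elts_leq // E.
Qed.

Lemma preceqP {n} (S S' : {set 'I_n}) :
  preceq S S' <->
  #|S| = #|S'| /\ forall q, q <= n -> cnt S' q <= cnt S q.
Proof.
split=> -[eqS H]; split=> //; last first.
  case=> [|i] // /= Hi; set q := nth 0 (elts S') i.
  rewrite nth_elts_leq //; apply: (@leq_trans (cnt S' q)).
    by rewrite -nth_elts_leq // -eqS.
  case: (leqP q n) => [/H // | nq].
  by rewrite !cntT -?eqS // ltnW.
move=> q _; case E : (cnt S' q) => [|c] //.
have cS := leq_cnt S' q; rewrite E -eqS in cS.
have /= Hc := H c.+1 cS.
rewrite -nth_elts_leq //; apply: leq_trans Hc _.
by rewrite nth_elts_leq -?eqS // E.
Qed.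

(** * Order shattering by a family determined by cardinality *)

(** The game with [p] positions left and [r] elements chosen above them: positions
of [S] belong to the adversary, since both values must be continued there. *)
Fixpoint win {n} (D : pred nat) (S : {set 'I_n}) (p r : nat) : bool :=
  if p is p'.+1 then
    if p \in elts S then win D S p' r && win D S p' r.+1
    else win D S p' r || win D S p' r.+1
  else D r.

(** The sets of allowed size with trace [R] above the lowest [p] positions: the
families that the recursion for order shattering passes through. *)
Definition fiber {n} (D : pred nat) (p : nat) (R : {set 'I_n}) :=
  [set C : {set 'I_n} | (C :&: [set x : 'I_n | p <= x] == R) && D #|C|].

Lemma order_shattersW {n} (F G : {set {set 'I_n}}) S :
  F \subset G -> order_shatters F S -> order_shatters G S.
Proof.
move=> sFG osF; case: osF sFG => {F S}
  [F F0 sFG | F F0 F1 S s sS le_s s0 s1 dis c0 c1 ha hb o0 o1 sFG].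
  by apply: OrderShatters0; apply: contraNneq F0 => G0; rewrite -subset0 -G0.
apply: (OrderShattersS sS le_s _ _ dis c0 c1 ha hb o0 o1);
  exact: subset_trans sFG.
Qed.

(** The recursive clause asks for subfamilies of the exact size, which any
order shattering family therefore contains. *)
Lemma order_shatters_card {n} (F : {set {set 'I_n}}) S :
  order_shatters F S ->
  exists F' : {set {set 'I_n}},
    [/\ F' \subset F, #|F'| = 2 ^ #|S| & order_shatters F' S].
Proof.
case=> {F S} [F /set0Pn[C CF] | F F0 F1 S s sS le_s s0 s1 dis c0 c1 ha hb o0 o1].
  exists [set C]; rewrite sub1set CF cards1 cards0; split=> //.
  by apply: OrderShatters0; apply/set0Pn; exists C; rewrite set11.
exists (F0 :|: F1); split; first by rewrite subUset s0.
  rewrite cardsU disjoint_setI0 // cards0 subn0 c0 c1 addnn -mul2n -expnS.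
  rewrite prednK //.
  by rewrite (cardD1 s) sS.
by apply: (OrderShattersS sS le_s _ _ dis c0 c1 ha hb o0 o1);
  rewrite ?subsetUl ?subsetUr.
Qed.

Lemma win_ext {n} D (S S' : {set 'I_n}) p :
  (forall x : 'I_n, x < p -> (x \in S) = (x \in S')) -> p <= n ->
  forall r, win D S p r = win D S' p r.
Proof.
elim: p => [|p IH] //= eqS pn r.
rewrite -[p]/(val (Ordinal pn)) !mem_elts eqS // !IH //; try exact: ltnW.
all: by move=> x xp; apply: eqS; exact: ltnW.
Qed.

Lemma win_setD1 {n} D (S : {set 'I_n}) (s : 'I_n) r :
  win D (S :\ s) s r = win D S s r.
Proof.
apply: win_ext; last exact: ltnW.
by move=> x xs; rewrite !inE; case: eqVneq => // E; move: xs; rewrite E ltnn.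
Qed.

(** Above the last element of [S] the player moves alone and can reach any total
that the number of free positions permits. *)
Lemma win_free {n} D (S : {set 'I_n}) q p r r' :
  (forall x : 'I_n, x \in S -> x < q) -> q <= p <= n ->
  r <= r' <= r + (p - q) -> win D S q r' -> win D S p r.
Proof.
move=> Sq /andP[qp pn]; rewrite -(subnKC qp) addKn.
elim: (p - q) r => [|k IH] r Hr Hw.
  by rewrite addn0 (_ : r = r') //; lia.
rewrite addnS /=; case: eltsP => [[x /Sq]|_]; first lia.
have [->|neq] := eqVneq r r'; first by rewrite IH //; lia.
by rewrite (IH r.+1) ?orbT //; lia.
Qed.

(** The common part of the sets in [F0] and [F1] above the largest element [s] of
[S] records the player's choices there; [F0] and [F1] are the two continuations
at [s]. *)
Lemma win_of_shatters {n} D (F : {set {set 'I_n}}) S :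
  order_shatters F S -> forall p R, p <= n ->
  (forall x : 'I_n, x \in S -> x < p) -> F \subset fiber D p R ->
  win D S p #|R|.
Proof.
pose low p := [set x : 'I_n | x < p].
have card_low p : p <= n -> #|low p| = p.
  move=> pn; have inj : injective (widen_ord pn).
    by move=> y z /(congr1 val) /= /val_inj.
  rewrite -[RHS](card_ord p) -(card_imset _ inj).
  apply: eq_card => x; rewrite inE.
  apply/idP/imsetP => [xp|[y _ ->]]; last exact: (ltn_ord y).
  by exists (Ordinal xp) => //; apply/val_inj.
elim=> {F S}
  [F Fn0 p R pn _ sF |
   F F0 F1 S s sS le_s s0 s1 dis c0 c1 ha hb o0 IH0 o1 IH1 p R pn Sp sF].
  case/set0Pn: Fn0 => C CF; have := subsetP sF _ CF.
  rewrite inE => /andP[/eqP<- DC].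
  have EC := cardsID [set x : 'I_n | p <= x] C.
  apply: (@win_free _ _ _ 0 p _ #|C|) => //; first by move=> x; rewrite inE.
  rewrite subn0 -EC leq_addr /= leq_add2l -[X in _ <= X](card_low p) //.
  by apply: subset_leq_card; apply/subsetP => x; rewrite !inE -ltnNge => /andP[].
have F1n0 : F1 != set0 by rewrite -card_gt0 c1 expn_gt0.
have F0n0 : F0 != set0 by rewrite -card_gt0 c0 expn_gt0.
case/set0Pn: F0n0 => C0 C0F; case/set0Pn: F1n0 => C1 C1F.
pose R' := [set x : 'I_n | s < x] :&: C0.
have sn := ltn_ord s; have sp := Sp _ sS.
have lt_s x : x \in S :\ s -> x < s.
  by rewrite !inE ltn_neqAle => /andP[xs /le_s ->]; rewrite andbT.
have sub0 : F0 \subset fiber D s R'.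
  apply/subsetP => C CF; have := subsetP sF _ (subsetP s0 _ CF).
  rewrite !inE => /andP[_ ->]; rewrite andbT; apply/eqP/setP => x.
  have [sC _] := hb _ _ CF C1F.
  have /setP/(_ x) := ha _ _ C0F C1F; have /setP/(_ x) := ha _ _ CF C1F.
  rewrite !inE => <- ->.
  by case: (ltngtP s x) => [||/val_inj <-]; rewrite ?andbT ?andbF ?(negbTE sC).
have sub1 : F1 \subset fiber D s (s |: R').
  apply/subsetP => C CF; have := subsetP sF _ (subsetP s1 _ CF).
  rewrite !inE => /andP[_ ->]; rewrite andbT; apply/eqP/setP => x.
  have [_ sC] := hb _ _ C0F CF; have /setP/(_ x) := ha _ _ C0F CF.
  rewrite !inE -val_eqE /= => ->.
  by case: (ltngtP s x) => [||/val_inj <-]; rewrite ?andbT ?andbF ?sC.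
have cR' : #|s |: R'| = #|R'|.+1 by rewrite cardsU1 !inE ltnn.
have W0 := IH0 s R' (ltnW sn) lt_s sub0.
have W1 := IH1 s _ (ltnW sn) lt_s sub1.
have ER : R = [set x : 'I_n | p <= x] :&: C0.
  by have := subsetP sF _ (subsetP s0 _ C0F); rewrite inE setIC => /andP[/eqP->].
apply: (@win_free _ _ _ s.+1 p _ #|R'|); first by move=> x /le_s.
- by rewrite sp.
- rewrite ER -(cardsID [set x : 'I_n | p <= x] R').
  have -> : R' :&: [set x : 'I_n | p <= x] = [set x : 'I_n | p <= x] :&: C0.
    apply/setP => x; rewrite !inE; case: (x \in C0); last by rewrite !andbF.
    rewrite !andbT; apply/andP/idP => [[] //|px]; split=> //.
    exact: leq_trans px.
  have -> : p - s.+1 = #|low p :\: low s.+1|.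
    rewrite cardsDS ?card_low //.
    by apply/subsetP => x; rewrite !inE => /leq_trans; apply.
  rewrite leq_addr leq_add2l /=.
  apply: subset_leq_card; apply/subsetP => x.
  by rewrite !inE -!ltnNge !ltnS => /andP[-> /andP[->]].
rewrite win_setD1 in W0; rewrite cR' win_setD1 in W1.
by rewrite /= mem_elts sS W0 W1.
Qed.

(** A position of [S] is its largest element when the recursion reaches it, and
the two fibers over it are disjoint and agree above it.  At a position outside
[S] the winning choice selects a smaller fiber. *)
Lemma shatters_of_win {n} D (S R : {set 'I_n}) p :
  p <= n -> (forall x : 'I_n, x \in S -> x < p) ->
  (forall x : 'I_n, x \in R -> p <= x) ->
  win D S p #|R| -> order_shatters (fiber D p R) S.
Proof.
elim: p S R => [|p IH] S R pn Sp Rp.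
  move=> /= DR; have -> : S = set0.
    by apply/setP => x; rewrite inE; apply/negP => /Sp.
  apply: OrderShatters0; apply/set0Pn; exists R; rewrite inE DR andbT.
  by apply/eqP/setP => x; rewrite !inE andbT.
pose s := Ordinal pn.
have sR : s \notin R by apply/negP => /Rp /=; rewrite ltnn.
have Rs x : x \in s |: R -> p <= x.
  by rewrite !inE => /orP[/eqP-> // | /Rp]; apply: ltnW.
have Rp' x : x \in R -> p <= x by move/Rp; apply: ltnW.
have cR : #|s |: R| = #|R|.+1 by rewrite cardsU1 sR.
have top C x : x \in C :&: [set y : 'I_n | p <= y] = 
    (x \in C :&: [set y : 'I_n | p < y]) || (x == s) && (s \in C).
  rewrite !inE leq_eqVlt -val_eqE /= eq_sym andb_orr orbC.
  congr (_ || _); rewrite andbC; case: eqP => // E.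
  by rewrite (_ : x = s) //; apply/val_inj.
have fib0 C : C \in fiber D p R -> s \notin C /\ C \in fiber D p.+1 R.
  rewrite !inE => /andP[/eqP/setP E ->].
  have sC : s \notin C by have := E s; rewrite !inE leqnn andbT (negbTE sR) => ->.
  split=> //; rewrite andbT; apply/eqP/setP => x; rewrite -E top.
  by rewrite (negbTE sC) andbF orbF.
have fib1 C : C \in fiber D p (s |: R) -> s \in C /\ C \in fiber D p.+1 R.
  rewrite !inE => /andP[/eqP/setP E ->].
  have sC : s \in C by have := E s; rewrite !inE leqnn andbT eqxx => ->.
  split=> //; rewrite andbT; apply/eqP/setP => x.
  have := E x; rewrite top sC andbT in_setU1.
  case: (eqVneq x s) => [-> _|_]; last by rewrite orbF.
  by rewrite (negbTE sR) !inE ltnn andbF.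
rewrite /= -[p]/(val s) mem_elts; case: ifP => sS /=; last first.
  have Sp' x : x \in S -> x < p.
    move=> xS; have := Sp _ xS; rewrite ltnS leq_eqVlt => /orP[/eqP E|//].
    by move: sS; rewrite (_ : s = x) ?xS //; apply/val_inj.
  case/orP => [w|w].
    apply: order_shattersW (IH _ _ (ltnW pn) Sp' Rp' w).
    by apply/subsetP => C /fib0[].
  rewrite -cR in w.
  apply: order_shattersW (IH _ _ (ltnW pn) Sp' Rs w).
  by apply/subsetP => C /fib1[].
case/andP => w0 w1; rewrite -cR in w1.
have Sp' x : x \in S :\ s -> x < p.
  rewrite !inE => /andP[xs /Sp]; rewrite ltnS leq_eqVlt => /orP[/eqP E|//].
  by case/eqP: xs; apply/val_inj.
rewrite -[p]/(val s) -win_setD1 in w0; rewrite -[p]/(val s) -win_setD1 in w1.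
have cS : #|S|.-1 = #|S :\ s| by rewrite (cardsD1 s S) sS.
have [F0 [s0 c0 o0]] := order_shatters_card (IH _ _ (ltnW pn) Sp' Rp' w0).
have [F1 [s1 c1 o1]] := order_shatters_card (IH _ _ (ltnW pn) Sp' Rs w1).
apply: (@OrderShattersS _ _ F0 F1 S s) => //.
- by apply/subsetP => C /(subsetP s0) /fib0[].
- by apply/subsetP => C /(subsetP s1) /fib1[].
- apply/pred0P => C /=; apply/negP => /andP[/(subsetP s0) /fib0[sC _]].
  by move=> /(subsetP s1) /fib1[]; rewrite (negbTE sC).
- by rewrite cS.
- by rewrite cS.
- move=> C E /(subsetP s0) /fib0[_] + /(subsetP s1) /fib1[_].
  rewrite !inE => /andP[/eqP<- _] /andP[/eqP + _].
  by rewrite !(setIC [set _ | _]).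
- move=> C E /(subsetP s0) /fib0[? _] /(subsetP s1) /fib1[? _]; by split.
Qed.

Lemma osh_win {n} (D : pred nat) (F : {set {set 'I_n}}) S :
  (forall C, (C \in F) = D #|C|) -> osh F S <-> win D S n 0.
Proof.
move=> FD; have -> : F = fiber D n set0.
  apply/setP => C; rewrite inE FD (_ : _ :&: _ = set0) ?eqxx //.
  by apply/setP => x; rewrite !inE leqNgt ltn_ord andbF.
have Sn (x : 'I_n) : x \in S -> x < n by [].
split=> [os|].
  by rewrite -(cards0 'I_n); apply: win_of_shatters os _ _ _ _ _.
by rewrite -(cards0 'I_n); apply: shatters_of_win => // x; rewrite inE.
Qed.

(** * The game for two layers *)

Definition ballot_upto {n} (S : {set 'I_n}) (p : nat) : Prop :=
  forall q, q <= p -> 2 * cnt S q <= q.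

(** The winning intervals for the two layers become contiguous at some [p0] and
their union stays nonempty up to [p]. *)
Definition merged {n} d (S : {set 'I_n}) (p : nat) : Prop :=
  exists p0, [/\ p0 <= p, ballot_upto S p0, d + 2 * cnt S p0 <= p0.+1
    & forall q, p0 <= q <= p -> 2 * cnt S q <= q + d].

Lemma ballot_uptoS {n} (S : {set 'I_n}) p :
  ballot_upto S p.+1 <-> ballot_upto S p /\ 2 * cnt S p.+1 <= p.+1.
Proof.
split=> [b | [b bp] q]; first by split=> [q qp|]; apply: b; lia.
by rewrite leq_eqVlt => /orP[/eqP->|/b].
Qed.

Lemma mergedS {n} d (S : {set 'I_n}) p :
  merged d S p.+1 <->
  merged d S p /\ 2 * cnt S p.+1 <= p.+1 + d \/
  ballot_upto S p.+1 /\ d + 2 * cnt S p.+1 <= p.+2.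
Proof.
split=> [[p0 [p0p b0 c0 m0]] | [[[p0 [p0p b0 c0 m0]] cp] | [b c]]].
- have [E|ne] := eqVneq p0 p.+1; first by right; rewrite -E.
  left; split; last by apply: m0; rewrite p0p leqnn.
  by exists p0; split=> // [|q qp]; [|apply: m0]; lia.
- exists p0; split=> // [|q]; first exact: leqW.
  case/andP=> p0q; rewrite leq_eqVlt => /orP[/eqP-> //|qp].
  by apply: m0; rewrite p0q.
- exists p.+1; split=> // q /andP[pq qp].
  have -> : q = p.+1 by lia.
  by have := b p.+1 (leqnn _); lia.
Qed.

Lemma ballot_upto_merged {n} d (S : {set 'I_n}) p :
  ballot_upto S p -> d + 2 * cnt S p <= p.+1 -> merged d S p.
Proof.
move=> b c; exists p; split=> // q qp.
have -> : q = p by lia.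
by have := b p (leqnn p); lia.
Qed.

(** Before merging, [r] must lie in one of the two intervals
[a - p + cnt S p, a - cnt S p] and its translate by [d]; after merging, in their
convex hull. An adversary's move from separated intervals cannot be answered by
using one interval for each value, because consecutive values of [r] in
different intervals would make these contiguous. *)
Lemma win_two_layers {n} (d a : nat) (S : {set 'I_n}) p r : 1 < d ->
  win (pred2 a (a + d)) S p r <->
  ballot_upto S p /\
    (r + cnt S p <= a /\ a + cnt S p <= r + p \/
     r + cnt S p <= a + d /\ a + d + cnt S p <= r + p) \/
  merged d S p /\ r + cnt S p <= a + d /\ a + cnt S p <= r + p.
Proof.
move=> d1; elim: p r => [|p IH] r.
  rewrite /= cnt0; split=> [|[[_ H]|[[p0 [p00 _ + _]] _]]].
  - move=> H; left; split; last lia.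
    by move=> q; rewrite leqn0 => /eqP->; rewrite cnt0.
  - lia.
  - by move: p00; rewrite leqn0 => /eqP->; rewrite cnt0; lia.
rewrite mergedS ballot_uptoS /=; have := cntS S p.
have Hb : ballot_upto S p -> 2 * cnt S p <= p by apply.
have Hm : merged d S p -> 2 * cnt S p <= p + d.
  by case=> p0 [? _ _]; apply; lia.
have Hbm : ballot_upto S p -> merged d S p \/ p.+1 < d + 2 * cnt S p.
  by move=> b; have [c|] := leqP; [left; exact: ballot_upto_merged | right].
case: ifP => _; rewrite ?addn0 ?addn1 => ->.
- split=> [/andP[/IH w0 /IH w1] | w].
    case: w0; case: w1; intuition lia.
  apply/andP; split; apply/IH; intuition lia.
- split=> [/orP[/IH | /IH] | w].
  + intuition lia.
  + intuition lia.
  apply/orP; rewrite !IH.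
  have [H1|H1] := leqP (a + cnt S p) (r + p);
  have [H2|H2] := leqP (a + d + cnt S p) (r + p);
  have [H3|H3] := leqP (r + cnt S p) a;
  intuition (try lia).
Qed.

Lemma osh_two_layers {n} d a (S : {set 'I_n}) : 1 < d ->
  osh (layer n a :|: layer n (a + d)) S <->
  ballot S /\
    (#|S| <= a /\ a + #|S| <= n \/ #|S| <= a + d /\ a + d + #|S| <= n) \/
  merged d S n /\ #|S| <= a + d /\ a + #|S| <= n.
Proof.
move=> d1; rewrite (@osh_win _ (pred2 a (a + d))); last first.
  by move=> C; rewrite !inE.
rewrite win_two_layers // cntT // !add0n ballotP.
suff E : ballot_upto S n <-> forall q, 2 * cnt S q <= q by rewrite E.
split=> b q; last by move=> _; apply: b.
have [/b //|nq] := leqP q n.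
by have := b n (leqnn n); rewrite (cntT _ (leqnn n)) (cntT _ (ltnW nq)); lia.
Qed.

(** * The two kinds of minimal sets *)

Lemma mem_evens m y : (y \in evens m) = [&& 0 < y, ~~ odd y & y <= 2 * m].
Proof.
apply/mapP/idP => [[i]|H]; first by rewrite mem_iota => H ->; lia.
by exists y./2; rewrite ?mem_iota; lia.
Qed.

Lemma cnt_B n m q : q <= n -> cnt (B n m) q = minn m q./2.
Proof.
elim: q => [|q IH] qn; first by rewrite cnt0; lia.
rewrite cntS IH 1?ltnW // -[q in q.+1 \in _]/(val (Ordinal qn)) mem_elts.
rewrite inE mem_evens /=; lia.
Qed.

Lemma cnt_Bj n d m j q : 0 < d -> q <= n ->
  cnt (Bj n d m j) q = minn m q./2 + minn j (q - (2 * m + d).-1).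
Proof.
move=> d0; elim: q => [|q IH] qn; first by rewrite cnt0; lia.
rewrite cntS IH 1?ltnW // -[q in q.+1 \in _]/(val (Ordinal qn)) mem_elts.
rewrite inE mem_cat mem_evens mem_iota /=; lia.
Qed.

Lemma card_B n m : 2 * m <= n -> #|B n m| = m.
Proof. by move=> mn; rewrite -(cntT _ (leqnn n)) cnt_B //; lia. Qed.

Lemma ballot_B n m : ballot (B n m).
Proof.
apply/ballotP => q; have [qn|nq] := leqP q n; first by rewrite cnt_B //; lia.
by rewrite (cntT _ (ltnW nq)) -(cntT _ (leqnn n)) cnt_B //; lia.
Qed.

(** If the intervals of [S] merge at [p], then [d > 2] makes
[p - 2 * cnt S p] at least 2, which below [B n m] happens only once all elements
of [S] have been passed; so [S] is ballot. *)
Lemma preceq_B_eq {n} d m (S : {set 'I_n}) : 2 < d -> 2 * m <= n ->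
  ballot S \/ merged d S n -> preceq S (B n m) -> S = B n m.
Proof.
move=> d2 mn bmS /preceqP[]; rewrite card_B // => cS leS.
have {}leS q : q <= n -> minn m q./2 <= cnt S q.
  by move=> qn; rewrite -(cnt_B m qn) leS.
have ltS q : cnt S q <= m by rewrite -cS leq_cnt.
suff bS q : q <= n -> 2 * cnt S q <= q.
  apply: cnt_inj => q qn; rewrite cnt_B //.
  by move: (bS q qn) (leS q qn) (ltS q); lia.
case: bmS => [/ballotP // | [p [pn bp dp _]] qn].
have [/bp //|pq] := leqP q p.
move: (leS p pn) (leS q qn) (ltS q); lia.
Qed.

(** The slack [q - 2 * cnt (Bj n d m j) q] reaches [d - 1] at [2 * m + d - 1], and
again only at [2 * (m + j) + d - 1], which exceeds [n]. So merging can only happen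
at the former place, with exactly [m] elements passed, and the remaining [j]
elements cannot precede the interval that follows. *)
Lemma preceq_Bj_eq {n} d m j (S : {set 'I_n}) : 2 < d -> 2 * m + d + j - 1 <= n ->
  n < 2 * (m + j) + d - 1 -> merged d S n ->
  preceq S (Bj n d m j) -> S = Bj n d m j.
Proof.
move=> d2 jn nj [p [pn bp dp _]] /preceqP[cS leS].
have d0 : 0 < d by lia.
have {}leS q : q <= n -> minn m q./2 + minn j (q - (2 * m + d).-1) <= cnt S q.
  by move=> qn; rewrite -(@cnt_Bj n) // leS.
have {}cS : #|S| = m + j by rewrite cS -(cntT _ (leqnn n)) cnt_Bj //; lia.
have Ep : p = (2 * m + d).-1 by have := leS p pn; lia.
have Cp : cnt S p = m by have := leS p pn; lia.
apply: cnt_inj => q qn; rewrite cnt_Bj //.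
have := leS q qn; have [qp|pq] := leqP q p.
  move: (bp q qp) (cnt_mono S qp); lia.
have : cnt S q <= m + (q - p).
  rewrite -Cp -{1}(subnKC (ltnW pq)); elim: (q - p) => [|i IH].
    by rewrite addn0 addn0.
  by rewrite addnS cntS; lia.
have := leq_cnt S q; lia.
Qed.

(** * Minimal ballot sets *)

Definition slide {n} (S : {set 'I_n}) (e e' : 'I_n) := e' |: S :\ e.

Lemma cnt_slide {n} (S : {set 'I_n}) (e e' : 'I_n) q :
  e \in S -> e' \notin S -> e'.+1 = e -> q <= n ->
  cnt (slide S e e') q = cnt S q + (q == e).
Proof.
move=> eS eS' E; elim: q => [|q IH] qn; first by rewrite !cnt0 -E.
have mem T : (q.+1 \in elts T) = (Ordinal qn \in T).
  exact: (mem_elts T (Ordinal qn)).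
rewrite !cntS IH 1?ltnW // !mem !inE -!val_eqE /=.
have [E1|n1] := eqVneq q e.
  rewrite (_ : Ordinal qn = e) ?eS; last exact/val_inj.
  by move: E1; lia.
have [E2|n2] := eqVneq q e'.
  rewrite (_ : Ordinal qn = e') ?(negbTE eS'); last exact/val_inj.
  by move: E2; lia.
by case: (_ \in S); lia.
Qed.

(** Moving an element beyond the merging position one step down raises a single
value of the counting function by one.  For a ballot set this costs a slack of 2,
which the merged interval tolerates. *)
Lemma minimal_tail_down_closed {n} d a p (S : {set 'I_n}) : 2 < d ->
  ballot S -> preceq_minimal (osh (layer n a :|: layer n (a + d))) S ->
  p <= n -> d + 2 * cnt S p <= p.+1 -> #|S| <= a + d -> a + #|S| <= n ->
  forall q, p < q -> q.+1 \in elts S -> q \in elts S.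
Proof.
move=> d2 /ballotP bS [_ minS] pn dp ka kn [//|q] pq /eltsP[e eS [Ee]].
apply/negPn/negP => qS.
have qn : q < n by have := ltn_ord e; lia.
pose e' := Ordinal qn; have eS' : e' \notin S by rewrite -mem_elts.
have cs r := @cnt_slide n S e e' r eS eS' Ee.
have cardS' : #|slide S e e'| = #|S|.
  rewrite -(cntT (slide S e e') (leqnn n)) -(cntT S (leqnn n)) cs //.
  by have := ltn_ord e; lia.
apply: (minS (slide S e e')).
  apply/osh_two_layers; first lia.
  right; rewrite cardS'; split=> //; exists p; split=> //.
  - move=> r rp; rewrite cs; last exact: leq_trans pn.
    by have := bS r; lia.
  - by rewrite cs //; lia.
  - move=> r /andP[_ rn]; rewrite cs //; have := bS r.
    by case: (r == e); lia.
split; first by apply/preceqP; split=> // r rn; rewrite cs // leq_addr.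
by move=> E; case/negP: eS'; rewrite -E !inE eqxx.
Qed.

(** A gap beyond [p] excludes all later elements, so the elements beyond [p] form
a run that starts at [p + 1]. *)
Lemma cnt_initial_run {n} p (S : {set 'I_n}) :
  (forall q, p < q -> q.+1 \in elts S -> q \in elts S) ->
  forall q, p <= q <= n -> cnt S q = cnt S p + minn (#|S| - cnt S p) (q - p).
Proof.
move=> dc.
have gap q i : p < q -> q \notin elts S ->
    cnt S (q + i) = cnt S q /\ q + i \notin elts S.
  move=> pq qS; elim: i => [|i [IHc IHe]]; first by rewrite addn0.
  have qi : (q + i).+1 \notin elts S.
    by apply: contra IHe; apply: dc; rewrite ltn_addr.
  by rewrite addnS cntS (negbTE qi) addn0.
have full q : p < q <= n -> q \notin elts S -> cnt S q = #|S|.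
  move=> /andP[pq qn] qS; have [+ _] := gap q (n - q) pq qS.
  by rewrite subnKC // (cntT S (leqnn n)) => ->.
move=> q /andP[pq qn]; rewrite -{1}(subnKC pq).
have : p + (q - p) <= n by rewrite subnKC.
elim: (q - p) => [|i IH] iN; first by rewrite addn0 minn0 addn0.
have := leq_cnt S (p + i.+1); have := leq_cnt S p.
move: iN; rewrite addnS => iN.
have pin : p < (p + i).+1 <= n by rewrite ltnS leq_addr.
have := full _ pin; rewrite cntS IH ?(ltnW iN) //.
case: (_ \in _) => /=; first lia.
by move=> /(_ isT); lia.
Qed.

(** [Bj n d m j] lies below [S], where [m] counts the elements of [S] up to the
first merging position: beyond that position the two have the same counting
function.  As [S] is ballot, so is [Bj n d m j], whence [j < d]. *)
Lemma minimal_large_Bj {n} d a (S : {set 'I_n}) : 2 < d ->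
  ballot S -> preceq_minimal (osh (layer n a :|: layer n (a + d))) S ->
  merged d S n -> #|S| <= a + d -> a + #|S| <= n ->
  exists m j, [/\ #|S| = m + j, 2 * m + 2 * j <= n, 2 * m + d + j <= n.+1,
    j < d & S = Bj n d m j].
Proof.
move=> d2 baS minS [p0 [p0n _ dp0 _]] ka kn; have /ballotP bS := baS.
have ex : exists p, d + 2 * cnt S p <= p.+1 by exists p0.
(* The walk q - 2 * cnt S q has steps of size one, so it first reaches the
   height d - 1 exactly. *)
case: (ex_minnP ex) => p dp minp.
have pn : p <= n by apply: leq_trans (minp _ dp0) p0n.
have Ep : d + 2 * cnt S p = p.+1.
  case: p dp minp {pn} => [|p] dp minp; first by move: dp; lia.
  have : ~~ (d + 2 * cnt S p <= p.+1) by apply/negP => /minp; rewrite ltnn.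
  by have := cnt_mono S (leqnSn p); lia.
have run := cnt_initial_run (minimal_tail_down_closed d2 baS minS pn dp ka kn).
set m := cnt S p in Ep dp run; set j := #|S| - m in run.
have kmj : #|S| = m + j by rewrite subnKC // leq_cnt.
have k2 : 2 * #|S| <= n by rewrite -(cntT S (leqnn n)) bS.
have jn : 2 * m + d + j <= n.+1.
  have := run n; rewrite pn leqnn (cntT S (leqnn n)) => /(_ isT).
  by lia.
have d0 : 0 < d by lia.
have jd : j < d.
  have := bS (p + j); rewrite run; last lia.
  by rewrite addKn minnn; lia.
have cBj q : q <= n ->
    2 * cnt (Bj n d m j) q <= q /\ cnt S q <= cnt (Bj n d m j) q.
  move=> qn; rewrite cnt_Bj //; have := bS q; have [qp|pq] := leqP q p.
    by have := cnt_mono S qp; rewrite -/m; lia.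
  by rewrite run ?qn ?(ltnW pq) //; lia.
have cardBj : #|Bj n d m j| = #|S|.
  by rewrite -(cntT _ (leqnn n)) cnt_Bj //; lia.
exists m, j; split=> //; first lia.
apply/esym; have [_ minS'] := minS.
have [//|/eqP neq] := eqVneq (Bj n d m j) S.
case: (minS' (Bj n d m j)); last first.
  by split=> //; apply/preceqP; split=> // q /cBj[].
apply/osh_two_layers; first lia.
right; rewrite cardBj; split=> //; exists p; split=> //.
- by move=> q qp; have [] := cBj q (leq_trans qp pn).
- by rewrite cnt_Bj //; lia.
- by move=> q /andP[_ /cBj[]]; lia.
Qed.

Lemma minimal_small_B {n} d a (S : {set 'I_n}) : 1 < d ->
  ballot S -> preceq_minimal (osh (layer n a :|: layer n (a + d))) S ->
  #|S| <= a /\ a + #|S| <= n \/ #|S| <= a + d /\ a + d + #|S| <= n ->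
  S = B n #|S|.
Proof.
move=> d1 /ballotP bS [_ minS] kM.
have cB : #|B n #|S| | = #|S|.
  apply: card_B; rewrite -(cntT S (leqnn n)); exact: bS.
apply/esym; have [//|/eqP neq] := eqVneq (B n #|S|) S.
case: (minS (B n #|S|)).
  apply/osh_two_layers => //; left; rewrite cB; split=> //; exact: ballot_B.
split=> //; apply/preceqP; split=> // q qn; rewrite cnt_B //.
by move: (bS q) (leq_cnt S q); lia.
Qed.

Unset Implicit Arguments.

Theorem theorem4p9 (d a n : nat) (hd : 2 < d) (han : a + d <= n) :
  let M := maxn (minn a (n - a)) (minn (a + d) (n - a - d)) in
  forall S : {set 'I_n},
    (ballot S /\ preceq_minimal (osh (layer n a :|: layer n (a + d))) S)
    <->
    (exists m : nat, m <= M /\ S = B n m)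
    \/
    (2 * a < n < 2 * (a + d) /\
     exists m j : nat,
       [/\ m <= a, 1 <= j, M < m + j,
           2 * m + 2 * j <= 2 * m + d + j - 1 <= n
         & S = Bj n d m j]).
Proof.
move=> M S.
have d1 : 1 < d by exact: ltnW.
have MP k : k <= M <-> k <= a /\ a + k <= n \/ k <= a + d /\ a + d + k <= n.
  by rewrite /M; lia.
split=> [[bS minS] | [[m [mM ->]] | [an [m [j [ma j0 Mmj jn ->]]]]]].
- have [kM|Mk] := leqP #|S| M.
    left; exists #|S|; split=> //.
    by apply: minimal_small_B bS minS _ => //; apply/MP.
  right; have [/(osh_two_layers _ _ d1)] := minS.
  case=> [[_ /MP]|[mS [ka kn]] _]; first by rewrite leqNgt Mk.
  have [m [j [kmj mjn jn jd ES]]] := minimal_large_Bj hd bS minS mS ka kn.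
  (* M equals n - a if n <= 2 * a and a + d if 2 * (a + d) <= n; the size of S
     is at most both, so neither case is compatible with M < #|S|. *)
  split; first by move: Mk; rewrite /M; lia.
  by exists m, j; split=> //; move: Mk; rewrite /M; lia.
- have mn : 2 * m <= n by move: mM; rewrite /M; lia.
  split; first exact: ballot_B.
  split.
    apply/osh_two_layers; rewrite ?card_B //; left.
    by split; [exact: ballot_B | apply/MP].
  move=> S' /(osh_two_layers _ _ d1) oS' [leS'].
  by apply; apply: preceq_B_eq hd mn _ leS'; case: oS' => -[]; [left|right].
have d0 : 0 < d by lia.
have cBj q : q <= n -> 2 * cnt (Bj n d m j) q <= q.
  by move=> qn; rewrite cnt_Bj //; lia.
have cardBj : #|Bj n d m j| = m + j.
  by rewrite -(cntT _ (leqnn n)) cnt_Bj //; lia.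
split.
  apply/ballotP => q; have [/cBj //|nq] := leqP q n.
  by have := cBj n (leqnn n); rewrite (cntT _ (leqnn n)) (cntT _ (ltnW nq)); lia.
split.
  apply/osh_two_layers => //; right; rewrite cardBj.
  split; last by move: Mmj; rewrite /M; lia.
  exists (2 * m + d).-1; split; first lia.
  - by move=> q qp; apply: cBj; lia.
  - by rewrite cnt_Bj //; lia.
  - by move=> q /andP[_ /cBj]; lia.
move=> S' /(osh_two_layers _ _ d1) oS' [leS']; apply.
apply: (preceq_Bj_eq hd _ _ _ leS'); [lia | move: Mmj; rewrite /M; lia |].
have /preceqP[cS' _] := leS'; rewrite cardBj in cS'.
case: oS' => [[_ /MP]|[]] //.
by rewrite cS' leqNgt Mmj.
Qed.
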